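(* Let $m<\omega$. If $(p_n)_{n<\omega}$ is a discrete sequence of relatively RK-$m$-minimal free ultrafilters on $\omega$ and $p$ is an RK-minimal free ultrafilter on $\omega$, then $\int_p p_n$ is relatively RK-$(m+1)$-minimal.
   Context: For $f:\omega\to\omega$ and a filter $p$ on $\omega$, $f(p)=\{B: f^{-1}(B)\in p\}$. For ultrafilters, $p\ge_{RK}q$ if $f(p)\supseteq q$ for some $f$; $p\approx q$ if $p\ge_{RK}q$ and $q\ge_{RK}p$. A free ultrafilter $u$ is RK-minimal if for every $f:\omega\to\omega$, $f(u)$ is principal or $f(u)\approx u$. A sequence $(p_n)$ of filters is discrete if there are pairwise disjoint sets $U_n\in p_n$. For a filter $p$ on $\omega$ and filters $p_n$ on $\omega$, $\int_p p_n=\bigcup_{P\in p}\bigcap_{n\in P}p_n$. A cascade is a tree $V$ without infinite branches and with least element $\emptyset_V$; $v^+$ is the set of immediate successors, $v^\uparrow$ the subcascade of $v$ and everything above it; $V$ is sequential if each non-maximal $v^+$ is countably infinite. Ranks: $r(v)=0$ for maximal $v$, else least ordinal greater than all $r(w)$, $w\in v^+$; $r(V)=r(\emptyset_V)$. Monotone: each $v^+$ can be enumerated with non-decreasing ranks. The contour $\int V$: principal at $v$ for maximal $v$; otherwise $\int v^\uparrow=\{A: A\cap\max v_k^\uparrow\in\int v_k^\uparrow$ for all but finitely many $k\}$; $\int V=\int\emptyset_V^\uparrow$. A monotone sequential contour of rank $\alpha$ is $\int V$ (as a filter on $\omega$) for a monotone sequential cascade of rank $\alpha$ with $\max V\subseteq\omega$.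 For $1\le\alpha<\omega_1$, $\mathcal{P}_\alpha$ is the class of ultrafilters on $\omega$ containing no monotone sequential contour of rank $\alpha$ but one of each rank $1\le\beta<\alpha$. An ultrafilter $u\in\mathcal{P}_\alpha$ is relatively RK-$\alpha$-minimal if for every $f:\omega\to\omega$ either $u\approx f(u)$ or $f(u)\in\mathcal{P}_\beta$ for some $\beta<\alpha$. *)

(* Defs.v *)
From mathcomp Require Import all_boot all_order.
From mathcomp Require Import mathcomp_extra boolp classical_sets functions.
From mathcomp Require Import cardinality filter.

Set Implicit Arguments.
Unset Strict Implicit.
Unset Printing Implicit Defensive.

Import Order.TTheory.
Local Open Scope classical_set_scope.

(* Countable ordinals. [OLsub a] denotes the least ordinal greater than all
   the [a n]; every ordinal below omega_1 is denoted by such a term, in many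
   ways, so equality of ordinals is [oeq], not Leibniz equality. *)
Inductive ord : Type := OZero | OLsub of nat -> ord.

Fixpoint ole (x y : ord) {struct x} : Prop :=
  match x with
  | OZero => True
  | OLsub a => forall n, match y with
                         | OZero => False
                         | OLsub b => exists k, ole (a n) (b k)
                         end
  end.

Definition olt (x y : ord) : Prop :=
  match y with
  | OZero => False
  | OLsub b => exists k, ole x (b k)
  end.

Definition oeq (x y : ord) : Prop := ole x y /\ ole y x.

Fixpoint ord_of_nat (n : nat) : ord :=
  if n is n'.+1 then OLsub (fun _ => ord_of_nat n') else OZero.

Section Cascades.
Local Open Scope order_scope.
Context {d : Order.disp_t} (V : bPOrderType d).

Definition is_maximal (v : V) : Prop := forall w, v <= w -> w = v.

Definition immediate_succ (v : V) : set V :=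
  [set w | v < w /\ forall x, ~ (v < x /\ x < w)].

Definition max_above (v : V) : set V := [set w | is_maximal w /\ v <= w].

Definition is_tree : Prop :=
  forall (v : V) (A : set V), A `<=` [set w | w <= v] -> A !=set0 ->
    exists2 a, A a & forall b, A b -> a <= b.

Definition is_branch (C : set V) : Prop :=
  total_on C (fun x y => x <= y) /\
  forall D : set V, C `<=` D -> total_on D (fun x y => x <= y) -> D = C.

Definition is_cascade : Prop :=
  is_tree /\ forall C, is_branch C -> finite_set C.

Definition sequential : Prop :=
  forall v, ~ is_maximal v -> (immediate_succ v #= [set: nat])%card.

Definition is_rank (r : V -> ord) : Prop :=
  forall v,
    (is_maximal v -> oeq (r v) OZero) /\
    (~ is_maximal v ->
       (forall w, immediate_succ v w -> olt (r w) (r v)) /\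
       (forall b, (forall w, immediate_succ v w -> olt (r w) b) ->
          ole (r v) b)).

Definition monotone_cascade (r : V -> ord) : Prop :=
  forall v, ~ is_maximal v ->
    exists2 e : nat -> V, set_bij [set: nat] (immediate_succ v) e &
      forall i j, (i <= j)%N -> ole (r (e i)) (r (e j)).

(* The contour of the subcascade above v, extended to a filter on all of V:
   only the trace of a set on [max_above v] matters. Being inductive is
   harmless, since a cascade has no infinite branch. *)
Inductive contour : V -> set (set V) :=
| contour_max v (A : set V) : is_maximal v -> A v -> contour v A
| contour_succ v (A F : set V) : ~ is_maximal v -> finite_set F ->
    (forall w, immediate_succ v w -> ~ F w ->
       contour w (A `&` max_above w)%classic) ->
    contour v A.

End Cascades.

(* The inclusion of max V in omega is given by a map l on V, of which only the
   restriction to the maximal elements is relevant. *)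
Definition monotone_sequential_contour (alpha : ord) (W : set_system nat) :
    Prop :=
  exists (d : Order.disp_t) (V : bPOrderType d) (r : V -> ord) (l : V -> nat),
    [/\ is_cascade V /\ sequential V,
        is_rank r /\ oeq (r \bot%O) alpha,
        monotone_cascade r,
        (forall v w, is_maximal v -> is_maximal w -> l v = l w -> v = w) &
        W = fmap l (contour (\bot%O : V))].

Definition free (p : set_system nat) : Prop := \bigcap_(A in p) A = set0.

Definition free_ultrafilter (p : set_system nat) : Prop :=
  UltraFilter p /\ free p.

Definition principal (p : set_system nat) : Prop :=
  exists n, p = principal_filter n.

Definition rk_ge (p q : set_system nat) : Prop :=
  exists f : nat -> nat, q `<=` fmap f p.

Definition rk_equiv (p q : set_system nat) : Prop := rk_ge p q /\ rk_ge q p.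

Definition rk_minimal (u : set_system nat) : Prop :=
  free_ultrafilter u /\
  forall f : nat -> nat, principal (fmap f u) \/ rk_equiv (fmap f u) u.

Definition discrete_sequence (q : nat -> set_system nat) : Prop :=
  exists2 U : nat -> set nat, (forall n, q n (U n)) & trivIset [set: nat] U.

Definition filter_integral (p : set_system nat) (q : nat -> set_system nat) :
    set_system nat :=
  \bigcup_(P in p) \bigcap_(n in P) q n.

(* The class P_alpha, for alpha >= 1 only: P_0 is empty by convention. *)
Definition ordinal_class (alpha : ord) (u : set_system nat) : Prop :=
  [/\ olt OZero alpha,
      UltraFilter u,
      (forall W, monotone_sequential_contour alpha W -> ~ (W `<=` u)) &
      forall beta, olt OZero beta -> olt beta alpha ->
        exists2 W, monotone_sequential_contour beta W & W `<=` u].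

Definition relatively_rk_minimal (alpha : ord) (u : set_system nat) : Prop :=
  ordinal_class alpha u /\
  forall f : nat -> nat,
    rk_equiv u (fmap f u) \/
    exists2 beta, olt beta alpha & ordinal_class beta (fmap f u).

(* Main.v *)
(* For k >= 1, the ultrafilters of class k are those that contain a
   contour of rank k - 1 but none of rank k (rank 0 meaning principal). Let
   u = int_p p_n. Functions are constant or injective on a set in p, which has
   three consequences. (1) If the s_n are discrete of class k for p-most n, then
   int_p s_n has class k + 1: a contour lim W_i of rank k + 1 contained in the
   integral, with W_i carried by disjoint D_i, either has some D_i in s_n for
   p-most n, and then a set in W_i missing from s_n is chosen separately for
   each n, or has no D_i in s_n for p-most n, and then sets missing from each
   s_n in a contour of rank k below lim W_i are merged by a
   pseudo-intersection. (2) For arbitrary ultrafilters s_n, either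
   s_n = int_p s_n for p-most n, or the s_n are discrete on a set in p.
   (3) With s_n = f(p_n), so that f(u) = int_p s_n: if the s_n are constant, f(u)
   is some f(p_n); if they are discrete, p-most of them have the same class
   j < m, whence f(u) has class j + 1 <= m by (1), or p-most of them are
   equivalent to p_n, and then f is injective on a set in u. *)
Require Import Defs.
From HB Require Import structures.
From mathcomp Require Import all_boot all_order.
From mathcomp Require Import mathcomp_extra boolp classical_sets functions.
From mathcomp Require Import cardinality filter.

Set Implicit Arguments.
Unset Strict Implicit.
Unset Printing Implicit Defensive.

Import Order.TTheory.
Local Open Scope classical_set_scope.

(** * Comparison of countable ordinals, in particular of the finite ones *)

Lemma ole_refl x : ole x x.
Proof. by elim: x => [|a IH] //= n; exists n. Qed.

Lemma oeq_refl x : oeq x x.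
Proof. by split; exact: ole_refl. Qed.

Lemma ole_trans x y z : ole x y -> ole y z -> ole x z.
Proof.
elim: x y z => [|a IH] [|b] [|c] //= ab bc n; try by case: (ab n) => // k; case: (bc k).
have [k ak] := ab n; have [l bl] := bc k.
by exists l; exact: IH ak bl.
Qed.

Lemma olt_le_trans x y z : olt x y -> ole y z -> olt x z.
Proof.
case: y z => [|b] [|c] //= [k xb] bc; first exact: bc k.
by have [l bl] := bc k; exists l; exact: ole_trans xb bl.
Qed.

(** Classical induction on [x]: if some [a n] is not below [y], then by induction every member of
    [y] is below [a n], so [y] is at most [a n] and hence below [x]. *)
Lemma ole_or_olt x y : ole x y \/ olt y x.
Proof.
elim: x y => [|a IH] y; first by left.
have [h|/existsNP[n nan]] := pselect (forall n, olt (a n) y).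
  by left => /= n; move: (h n); case: y {h}.
right; exists n; case: y nan => [|b] //= nb k.
have [ab|] := IH n (b k); first by case: nb; exists k.
by case: (a n).
Qed.

Lemma ole_nat j k : j <= k -> ole (ord_of_nat j) (ord_of_nat k).
Proof. by elim: j k => [|j IH] [|k] //= jk n; exists 0; exact: IH. Qed.

Lemma olt_nat j k : j < k -> olt (ord_of_nat j) (ord_of_nat k).
Proof. by case: k => // k jk; exists 0; exact: ole_nat. Qed.

Lemma olt_nat_inv j k : olt (ord_of_nat j) (ord_of_nat k) -> j < k.
Proof.
case: k => //= k [_]; elim: j k => [|j IH] [|k] //= h; case: (h 0) => // _.
exact: IH.
Qed.

Lemma ole_nat_inv b k : ole b (ord_of_nat k) ->
  exists2 j, j <= k & oeq b (ord_of_nat j).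
Proof.
elim: k => [|k IH] bk; first by exists 0.
have [kb|[_ bk']] := ole_or_olt (ord_of_nat k.+1) b; first by exists k.+1.
by have [j jk bj] := IH bk'; exists j => //; exact: leqW.
Qed.

Lemma olt_nat_between b k : olt OZero b -> olt b (ord_of_nat k.+1) ->
  exists2 j, j < k & oeq b (ord_of_nat j.+1).
Proof.
move=> b0 bk; have [|j jk [bj jb]] := @ole_nat_inv b k; first by case: bk.
case: j jk bj jb => [|j] jk bj jb; first by have := olt_le_trans b0 bj.
by exists j.
Qed.

(** * Ultrafilters on omega *)

Lemma ultrafilterP (u : set_system nat) :
  UltraFilter u <-> ProperFilter u /\ forall A, u A \/ u (~` A).
Proof.
split=> [uU|[uP uA]]; first by split=> [|A];
  [exact: ultra_proper|exact: in_ultra_setVsetC].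
split=> // G GP uG; rewrite eqEsubset; split=> // A GA.
have [//|/uG GnA] := uA A.
by case: (@filter_not_empty _ G _); rewrite -(setICr A); exact: filterI.
Qed.

Section Ultrafilter.
Variables (u : set_system nat) (uU : UltraFilter u).

Lemma ultra_set0 : ~ u set0.
Proof. exact: filter_not_empty. Qed.

Lemma ultra_setC A : u (~` A) <-> ~ u A.
Proof.
split=> [uC uA|nA]; last by have [] := in_ultra_setVsetC A uU.
by case: (@filter_not_empty _ u _); rewrite -(setICr A); exact: filterI.
Qed.

Lemma ultra_fmap (f : nat -> nat) : UltraFilter (fmap f u).
Proof.
by apply/ultrafilterP; split=> [|A];
  [exact: fmap_proper_filter|exact: (in_ultra_setVsetC (f @^-1` A) uU)].
Qed.

Lemma ultra_sub_eq (v : set_system nat) : UltraFilter v -> v `<=` u -> u = v.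
Proof. by move=> vU vu; apply: max_filter. Qed.

Lemma ultra_finite_cover (P : nat -> set nat) k :
  u (\bigcup_(i in `I_k) P i) -> exists2 i, i < k & u (P i).
Proof.
elim: k => [|k IH]; first by rewrite II0 bigcup_set0 => /filter_not_empty.
have [uP _|/ultra_setC uP uU'] := pselect (u (P k)); first by exists k.
have [|i ik Pi] := IH; last by exists i => //; exact: ltnW.
apply: filterS (filterI uP uU') => x [nPx [i /= + Pix]].
by rewrite ltnS leq_eqVlt => /orP[/eqP ik|ik]; [rewrite ik in Pix|exists i].
Qed.

End Ultrafilter.

Lemma filter_bigcap_finite (u : set_system nat) (F : set nat) (A : nat -> set nat) :
  Filter u -> finite_set F -> (forall i, F i -> u (A i)) -> u (\bigcap_(i in F) A i).
Proof.
move=> uF /finite_fsetP[X ->] uA; exact: filter_bigI.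
Qed.

Lemma ultra_free_cofinite (u : set_system nat) (F : set nat) :
  free_ultrafilter u -> finite_set F -> u (~` F).
Proof.
move=> [uU fr] finF.
have -> : ~` F = \bigcap_(x in F) ~` [set x].
  by rewrite eqEsubset; split=> [y nFy x Fx /= yx|y h Fy]; [rewrite yx in nFy|exact: (h y Fy)].
apply: filter_bigcap_finite => // x _; apply/ultra_setC => // ux.
have : (\bigcap_(A in u) A) x.
  move=> A uA; apply: contrapT => nAx; apply: (ultra_set0 uU).
  by apply: filterS (filterI uA ux) => y [Ay /= yx]; rewrite yx in Ay.
by rewrite fr.
Qed.

Lemma free_ultra_infinite (u : set_system nat) (P : set nat) :
  free_ultrafilter u -> u P -> infinite_set P.
Proof.
move=> uf uP fP; have [uU _] := uf.
by have /(ultra_setC uU) := ultra_free_cofinite uf fP.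
Qed.

(** * Maps that fix an ultrafilter *)

(* If [h(u) = u], no colouring can separate [x] from [h x] for [u]-most [x];
   such colourings exist on [h x < x] and on [x < h x], so [h x = x] for
   [u]-most [x]. *)
Fixpoint descent_parity (h : nat -> nat) n x :=
  if n is n'.+1 then
    if h x < x then ~~ descent_parity h n' (h x) else false
  else false.

(** The colour of [x] is the parity of the length of the descent [x > h x > h (h x) > ...]. It has
    at most [x] steps, so [x] is enough fuel. *)
Lemma descending_coloring (h : nat -> nat) :
  exists c : nat -> bool, forall x, h x < x -> c (h x) = ~~ c x.
Proof.
have parE n x : x <= n -> descent_parity h n x = descent_parity h x x.
  elim: n {-2}n (leqnn n) x => [|N IH] [|n] // nN [|x] // xn.
  rewrite /=; case: ifP => // hx.
  have IHx k : x <= k -> k <= N ->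
      descent_parity h k (h x.+1) = descent_parity h (h x.+1) (h x.+1).
    by move=> xk kN; rewrite IH // (leq_trans _ xk).
  by rewrite (IHx n) // (IHx x) //; exact: leq_trans xn nN.
by exists (fun x => descent_parity h x x) => -[//|x] hx /=; rewrite hx negbK parE.
Qed.

(** Since [h] has no periodic points, two merging orbits meet with a well-defined difference of
    exponents. Each class [R x] of merging orbits gets a representative, and the colour of [x] is
    the parity of the total number of steps that [x] and the representative take to a common
    point. *)
Lemma ascending_coloring (h : nat -> nat) : (forall x, x < h x) ->
  exists c : nat -> bool, forall x, c (h x) = ~~ c x.
Proof.
move=> hx.
have itlt m n x : m < n -> iter m h x < iter n h x.
  elim: n => // n IH; rewrite ltnS leq_eqVlt => /orP[/eqP ->|mn] //=.
  by rewrite (ltn_trans (IH mn)).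
have itinj m n x : iter m h x = iter n h x -> m = n.
  move=> e; have [mn|nm|//] := ltngtP m n.
    by have := itlt _ _ x mn; rewrite e ltnn.
  by have := itlt _ _ x nm; rewrite e ltnn.
pose R x := [set y | exists m n, iter m h x = iter n h y].
have Rh x : R (h x) = R x.
  rewrite eqEsubset; split=> y [m [n e]].
    by exists m.+1, n; rewrite iterSr.
  by exists m, n.+1; rewrite -iterSr !iterS e.
pose c x := `[< exists m n, iter m h x = iter n h (xget 0 (R x)) /\ odd (m + n) >].
exists c => x; apply/idP/negP.
  move=> /asboolP[m [n [e o]]] /asboolP[m' [n' [e' o']]].
  rewrite Rh in e.
  have : n + m' = n' + m.+1.
    apply: (itinj _ _ (xget 0 (R x))).
    by rewrite (addnC n) (addnC n') !iterD -e -e' -iterSr -!iterD addnC.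
  by move/(congr1 odd); move: o o'; rewrite !oddD /=; 
  by case: (odd m); case: (odd n); case: (odd m'); case: (odd n').
move=> nc; apply/asboolP.
have [m [n e]] : R x (xget 0 (R x)).
  by apply: (@xgetPex _ 0 (R x)); exists x; exists 0, 0.
exists m, n.+1; rewrite Rh -iterSr iterS e; split=> //.
rewrite addnS /= ; apply/negP => o; apply: nc; apply/asboolP.
by exists m, n.
Qed.

(** As [h] preserves [u], the colour of [x] is true for [u]-most [x] exactly when the colour of
    [h x] is, so the two agree on a set in [u]. *)
Lemma ultra_coloring (u : set_system nat) (h : nat -> nat) (c : nat -> bool) :
  UltraFilter u -> fmap h u = u -> ~ u [set x | c (h x) = ~~ c x].
Proof.
move=> uU hu uc.
have cE : u [set x | c x] <-> u [set x | c (h x)] by rewrite -[in X in X <-> _]hu.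
have [u1|/(ultra_setC uU) u0] := pselect (u [set x | c x]).
  apply: (ultra_set0 uU).
  apply: filterS (filterI uc (filterI u1 (cE.1 u1))) => x [/= e [cx chx]].
  by rewrite chx cx in e.
have : u [set x | c (h x)].
  by apply: filterS (filterI uc u0) => x [/= -> /negP].
by move=> /cE; apply/ultra_setC.
Qed.

Lemma ultra_fixed (u : set_system nat) (h : nat -> nat) :
  UltraFilter u -> fmap h u = u -> u [set x | h x = x].
Proof.
move=> uU hu; apply: contrapT => nu.
have [ult|/(ultra_setC uU) unlt] := pselect (u [set x | h x < x]).
  have [c cP] := descending_coloring h.
  by apply: (ultra_coloring (c := c) uU hu); apply: filterS ult => x /cP.
have ugt : u [set x | x < h x].
  move/(ultra_setC uU) in nu; apply: filterS (filterI nu unlt) => x [/= /eqP ne /negP].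
  by rewrite -leqNgt leq_eqVlt eq_sym (negPf ne).
(* [ascending_coloring] asks for a map that raises every point, so off the set in [u] the successor
   replaces [h x]. *)
pose h' x := if x < h x then h x else x.+1.
have [|c cP] := @ascending_coloring h'; first by move=> x; rewrite /h'; case: ifP.
apply: (ultra_coloring (c := c) uU hu); apply: filterS ugt => x /= xh.
by rewrite -cP /h' xh.
Qed.

(** * The Rudin-Keisler order and selective ultrafilters *)

Lemma fmap_comp (f g : nat -> nat) (u : set_system nat) :
  fmap g (fmap f u) = fmap (g \o f) u.
Proof. by []. Qed.

Lemma rk_ge_fmap (u v : set_system nat) : UltraFilter u -> UltraFilter v ->
  rk_ge u v -> exists f, v = fmap f u.
Proof.
move=> uU vU [f vf]; exists f; symmetry.
exact: (ultra_sub_eq (ultra_fmap uU f) vU vf).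
Qed.

(** If [g] maps [f(u)] back to [u], then [g \o f] fixes [u], hence is the identity on a set in [u];
    there [f] has a left inverse. *)
Lemma rk_equiv_fmap_inj (u : set_system nat) (f : nat -> nat) : UltraFilter u ->
  rk_ge (fmap f u) u -> exists2 U, u U & {in U &, injective f}.
Proof.
move=> uU /(rk_ge_fmap (ultra_fmap uU f) uU)[g ug].
exists [set x | g (f x) = x].
  by apply: (ultra_fixed (h := g \o f) uU); rewrite -fmap_comp.
by move=> x y; rewrite !inE /= => gx gy xy; rewrite -gx -gy xy.
Qed.

Lemma inj_rk_equiv (u : set_system nat) (f : nat -> nat) U : Filter u ->
  u U -> {in U &, injective f} -> rk_equiv u (fmap f u).
Proof.
move=> uF uU fi; split; first by exists f.
pose g y := xget 0 [set x | U x /\ f x = y].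
have gf x : U x -> g (f x) = x.
  move=> Ux; have [Ug fg] : U (g (f x)) /\ f (g (f x)) = f x.
    by apply: (@xgetPex _ 0 [set z | U z /\ f z = f x]); exists x.
  by apply: fi => //; rewrite inE.
exists g => A uA; suff : u [set x | A (g (f x))] by [].
by apply: filterS (filterI uA uU) => x [Ax Ux]; rewrite /= gf.
Qed.

Definition selective (p : set_system nat) := forall f : nat -> nat,
  (exists i, p [set n | f n = i]) \/ exists2 P, p P & {in P &, injective f}.

Lemma rk_minimal_selective p : rk_minimal p -> selective p.
Proof.
move=> [[pU pf] pm] f; have [[i fi]|[fp _]] := pm f; last first.
  by right; exact: rk_equiv_fmap_inj.
by left; exists i; have : fmap f p [set i]; rewrite // fi => x /= ->.
Qed.

(** * Contours of finite rank as filters on omega *)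

(** The contour operation at a single node: the limit of the [V i] along the cofinite filter on
    [I]. *)
Definition limit_filter (I : set nat) (V : nat -> set_system nat) : set_system nat :=
  [set A | finite_set [set i | I i /\ ~ V i A]].

(* [contour_on k D W]: [W] is a monotone sequential contour of finite rank [k]
   carried by [D]. Successors of lower rank are dropped, since there are only
   finitely many of them. *)
Fixpoint contour_on k (D : set nat) (W : set_system nat) : Prop :=
  if k is k'.+1 then
    exists (I : set nat) (E : nat -> set nat) (V : nat -> set_system nat),
      [/\ infinite_set I, trivIset I E,
          forall i, I i -> E i `<=` D /\ contour_on k' (E i) (V i) &
          W = limit_filter I V]
  else exists2 x, D x & W = principal_filter x.

Lemma limit_filterW I V A : (forall i, I i -> V i A) -> limit_filter I V A.
Proof.
move=> VA; rewrite /limit_filter /=.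
by rewrite (_ : [set i | _] = set0) // -subset0 => i [/VA].
Qed.

Lemma limit_filter_proper I V : infinite_set I ->
  (forall i, I i -> ProperFilter (V i)) -> ProperFilter (limit_filter I V).
Proof.
move=> Iinf VP; split; [|split].
- move=> fI; apply: Iinf; apply: sub_finite_set fI => i Ii; split=> // Vi0.
  by have VPi := VP i Ii; exact: (@filter_not_empty _ _ VPi Vi0).
- by apply: limit_filterW => i Ii; have VPi := VP i Ii; exact: filterT.
- move=> A B fA fB; have : finite_set ([set i | I i /\ ~ V i A] `|` [set i | I i /\ ~ V i B]).
    by rewrite finite_setU.
  apply: sub_finite_set => i [Ii nVi]; have VPi := VP i Ii.
  have [VA|] := pselect (V i A); last by left.
  by right; split=> // VB; apply: nVi; exact: filterI.
- move=> A B AB; apply: sub_finite_set => i [Ii nVi]; split=> // VA; apply: nVi.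
  by have VPi := VP i Ii; apply: filterS VA.
Qed.

Lemma contour_on_limit k D W : contour_on k.+1 D W ->
  exists (I : set nat) (E : nat -> set nat) (V : nat -> set_system nat),
    [/\ infinite_set I, trivIset I E,
        forall i, I i -> E i `<=` D /\ contour_on k (E i) (V i) &
        W = limit_filter I V].
Proof. by []. Qed.

Lemma contour_on_proper k D W : contour_on k D W -> ProperFilter W.
Proof.
elim: k D W => [|k IH] D W /=; first by move=> [x _ ->]; exact: principal_filter_proper.
move=> [I [E [V [Iinf _ EV ->]]]].
by apply: limit_filter_proper => // i /EV[_ /IH].
Qed.

Lemma contour_on_carrier k D W : contour_on k D W -> W D.
Proof.
elim: k D W => [|k IH] D W /=; first by move=> [x Dx ->] y /= ->.
move=> [I [E [V [Iinf _ EV ->]]]]; apply: limit_filterW => i /EV[ED /[dup] cE /IH].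
by have VP := contour_on_proper cE; apply: filterS.
Qed.

Lemma contour_on_sub k D D' W : D `<=` D' -> contour_on k D W -> contour_on k D' W.
Proof.
case: k => [|k] DD' /=; first by move=> [x Dx ->]; exists x => //; exact: DD'.
move=> [I [E [V [Iinf tE EV ->]]]]; exists I, E, V; split=> // i /EV[ED cE].
by split=> //; exact: subset_trans ED DD'.
Qed.

(** The new filter is the one generated by [W] and [U]. Subtrees whose filter contains the
    complement of [U] are pruned; infinitely many remain because [W] does not contain it, and a
    pruned one never counts among the exceptions. *)
Lemma contour_on_trace k D W U : contour_on k D W -> ~ W (~` U) ->
  contour_on k (D `&` U) [set A | W (A `|` ~` U)].
Proof.
elim: k D W => [|k IH] D W /=.
  move=> [x Dx ->] nU; have Ux : U x by apply: contrapT => nUx; apply: nU => y /= ->.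
  exists x => //; rewrite eqEsubset; split=> A /= xA y /= yx.
    by have := xA y yx; rewrite yx => -[].
  by left; exact: xA.
move=> [I [E [V [Iinf tE EV ->]]]] nU.
exists [set i | I i /\ ~ V i (~` U)], (fun i => E i `&` U),
  (fun i => [set A | V i (A `|` ~` U)]); split=> //.
- move=> i j [Ii _] [Ij _] [x [[Eix _] [Ejx _]]].
  by apply: tE => //; exists x.
- move=> i [Ii nVi]; have [ED cE] := EV i Ii.
  by split; [exact: setSI|exact: IH].
- rewrite eqEsubset; split=> A; apply: sub_finite_set => i; first by move=> [[Ii _] nV].
  move=> [Ii nV]; split=> //; split=> // VU; apply: nV.
  have VP := contour_on_proper (EV i Ii).2.
  by apply: filterS VU; exact: subsetUr.
Qed.

Lemma contour_on_fmap k D W (f : nat -> nat) : {in D &, injective f} ->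
  contour_on k D W -> contour_on k (f @` D) (fmap f W).
Proof.
elim: k D W => [|k IH] D W fi /=.
  move=> [x Dx ->]; exists (f x); first by exists x.
  by rewrite eqEsubset; split=> A /= xA y /= ->; exact: xA.
move=> [I [E [V [Iinf tE EV ->]]]].
exists I, (fun i => f @` E i), (fun i => fmap f (V i)); split=> //.
- move=> i j Ii Ij [_ [[x Eix <-] [y Ejy yx]]].
  apply: tE => //; exists x; split=> //.
  by rewrite -(fi y x) // inE; [exact: (EV j Ij).1|exact: (EV i Ii).1].
- move=> i Ii; have [ED cE] := EV i Ii; split; first exact: image_subset.
  by apply: IH => // x y; rewrite !inE => /ED Dx /ED Dy; apply: fi; rewrite inE.
Qed.

(** A point lies in at most one of the disjoint carriers [E i], and every other [V i] contains its
    complement. *)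
Lemma contour_on_free k D W x : contour_on k.+1 D W -> W (~` [set x]).
Proof.
move=> [I [E [V [Iinf tE EV ->]]]].
have Vx i : I i -> ~ E i x -> V i (~` [set x]).
  move=> Ii nEx; have [_ cE] := EV i Ii; have VP := contour_on_proper cE.
  by apply: filterS (contour_on_carrier cE) => y Ey /= yx; rewrite yx in Ey.
have [[i [Ii Eix]]|nE] := pselect (exists i, I i /\ E i x); last first.
  by apply: limit_filterW => i Ii; apply: Vx => // Eix; apply: nE; exists i.
apply: sub_finite_set (finite_set1 i) => j [Ij nV]; apply: tE => //.
by exists x; split=> //; apply: contrapT => nEj; exact: nV (Vx j Ij nEj).
Qed.

Lemma frechet_contour_on (D : set nat) : infinite_set D ->
  contour_on 1 D [set A | finite_set (D `\` A)].
Proof.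
move=> Dinf; exists D, (fun i => [set i]), (fun i => principal_filter i); split=> //.
- by move=> i j _ _ [x [/= <- <-]].
- by move=> i Di; split=> [x /= ->//|]; exists i.
- rewrite eqEsubset; split=> A; apply: sub_finite_set => i [Di nA]; split=> //.
    by move=> Ai; apply: nA => y /= ->.
  by move=> iA; apply: nA; exact: iA.
Qed.

(** By induction each [V i] is lowered. The base case is rank two, where the Fréchet filter of [D]
    works because [W] is free. From rank one to rank zero the analogue fails, a free proper filter
    containing no principal one. *)
Lemma contour_on_pred k D W : contour_on k.+2 D W ->
  exists2 W', contour_on k.+1 D W' & W' `<=` W.
Proof.
elim: k D W => [|k IH] D W cW.
  have WP := contour_on_proper cW; have WD := contour_on_carrier cW.
  have Wfin F : finite_set F -> W (~` F).
    move=> finF; rewrite (_ : ~` F = \bigcap_(x in F) ~` [set x]); last first.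
      by rewrite eqEsubset; split=> [y nFy x Fx /= yx|y h Fy]; [rewrite yx in nFy|exact: (h y Fy)].
    by apply: filter_bigcap_finite => // x _; exact: contour_on_free cW.
  exists [set A | finite_set (D `\` A)].
    apply: frechet_contour_on => Dfin; apply: (@filter_not_empty _ W).
    by rewrite -(setICr D); apply: filterI => //; exact: Wfin.
  by move=> A /= /Wfin WDA; apply: filterS (filterI WD WDA) => x [Dx] /not_andP[//|/contrapT].
move: cW => [I [E [V [Iinf tE EV ->]]]].
have /choice[V' V'P] i : exists V', I i -> contour_on k.+1 (E i) V' /\ V' `<=` V i.
  have [Ii|nIi] := pselect (I i); last by exists set0.
  by have [V' cV' V'V] := IH _ _ (EV i Ii).2; exists V'.
exists (limit_filter I V').
  exists I, E, V'; split=> // i Ii; split; first exact: (EV i Ii).1.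
  exact: (V'P i Ii).1.
move=> A; apply: sub_finite_set => i [Ii nV]; split=> // /((V'P i Ii).2).
exact: nV.
Qed.

(** * Ultrafilters and the contours they contain *)

Definition has_contour k (u : set_system nat) :=
  exists2 W, contour_on k setT W & W `<=` u.

Lemma has_contour_pred k u : has_contour k.+2 u -> has_contour k.+1 u.
Proof.
move=> [W /contour_on_pred[W' cW' W'W] Wu]; exists W' => //.
exact: subset_trans W'W Wu.
Qed.

Lemma has_contour_trace k u U : UltraFilter u -> u U -> has_contour k u ->
  exists2 W, contour_on k U W & W `<=` u.
Proof.
move=> uU uUU [W cW Wu]; exists [set A | W (A `|` ~` U)].
  rewrite -[U in contour_on k U]setTI; apply: contour_on_trace => // /Wu.
  by move/(ultra_setC uU); apply.
move=> A /Wu uA; apply: filterS (filterI uA uUU) => x [[]//].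
Qed.

Lemma has_contour_fmap k u f U : UltraFilter u -> u U -> {in U &, injective f} ->
  has_contour k u -> has_contour k (fmap f u).
Proof.
move=> uU uUU fi /(has_contour_trace uU uUU)[W cW Wu].
exists (fmap f W); last by move=> A /Wu.
exact: contour_on_sub (contour_on_fmap fi cW).
Qed.

Lemma free_has_contour u : free_ultrafilter u -> has_contour 1 u.
Proof.
move=> uf; exists [set A | finite_set (setT `\` A)].
  by apply: frechet_contour_on; exact: infinite_nat.
by move=> A /= /(ultra_free_cofinite uf); rewrite setTD setCK.
Qed.

(** Rank zero is out of reach of [has_contour_pred] and is treated apart: an ultrafilter that is not
    free has a point common to all its sets. *)
Lemma principal_has_contour u : UltraFilter u -> ~ has_contour 1 u ->
  has_contour 0 u.
Proof.
move=> uU nu; have nfree : ~ free u by move=> uf; apply: nu; exact: free_has_contour.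
have [x xu] : \bigcap_(A in u) A !=set0 by apply/set0P/eqP.
exists (principal_filter x); first by exists x.
move=> A xA; apply: contrapT => /(ultra_setC uU) /xu; apply.
exact: xA.
Qed.

(* The class P_(k.+1): the index is shifted, as P_0 is empty. *)
Definition finite_class k u :=
  [/\ UltraFilter u, has_contour k u & ~ has_contour k.+1 u].

Lemma has_contour_le j k u : j <= k -> has_contour k.+1 u -> has_contour j.+1 u.
Proof. by move=> /subnK <-; elim: (k - j) => // n IH /has_contour_pred. Qed.

(** An equivalence makes [f] injective on a set in [u], and some [g] with [g(f(u)) = u] injective on
    a set in [f(u)]. Injective images of contours are contours, so both conditions transfer. *)
Lemma finite_class_fmap k u f : finite_class k u -> rk_equiv u (fmap f u) ->
  finite_class k (fmap f u).
Proof.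
move=> [uU uk nuk] [_ fu]; have fuU := ultra_fmap uU f.
have [U uUU fi] := rk_equiv_fmap_inj uU fu.
split=> //; first exact: has_contour_fmap uUU fi uk.
have [g ug] := rk_ge_fmap fuU uU fu.
have [|U' U'u gi] := @rk_equiv_fmap_inj (fmap f u) g fuU; first by rewrite -ug; exists f.
by move=> /(has_contour_fmap fuU U'u gi); rewrite -ug.
Qed.

(** * Integrals along an ultrafilter *)

Lemma filter_integralE p s A : Filter p ->
  filter_integral p s A <-> p [set n | s n A].
Proof.
move=> pF; split=> [[P pP sA]|pA]; last by exists [set n | s n A] => // n.
by apply: filterS pP => n /sA.
Qed.

Section Integral.
Variables (p : set_system nat) (s : nat -> set_system nat).
Hypotheses (p_free : free_ultrafilter p).

Local Instance pU : UltraFilter p := p_free.1.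

Lemma filter_integral_ultra : p [set n | UltraFilter (s n)] ->
  UltraFilter (filter_integral p s).
Proof.
have pF : Filter p by exact: _.
move=> ps; have pE A := @filter_integralE p s A pF.
have iF : Filter (filter_integral p s).
  split.
- by apply/pE; apply: filterS ps => n /= sU; exact: filterT.
- move=> A B /pE pA /pE pB; apply/pE; apply: filterS (filterI ps (filterI pA pB)).
  by move=> n [/= sU [sA sB]]; exact: filterI.
- move=> A B AB /pE pA; apply/pE; apply: filterS (filterI ps pA) => n [/= sU sA].
  exact: filterS sA.
apply/ultrafilterP; split; first split=> //.
  move=> /pE p0; apply: (ultra_set0 pU); apply: filterS (filterI ps p0) => n [/= sU].
  exact: ultra_set0.
move=> A; rewrite !pE.
have [pA|/(ultra_setC pU) pnA] := pselect (p [set n | s n A]); first by left.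
by right; apply: filterS (filterI ps pnA) => n [/= sU nA]; exact/ultra_setC.
Qed.

Lemma filter_integral_fmap (f : nat -> nat) :
  fmap f (filter_integral p s) = filter_integral p (fun n => fmap f (s n)).
Proof.
rewrite eqEsubset; split=> A; first by move=> /filter_integralE sA; apply/filter_integralE.
by move=> /filter_integralE sA; apply/filter_integralE.
Qed.

Variables (P : set nat) (G : nat -> set nat) (k : nat).
Hypotheses (pP : p P) (tG : trivIset P G) (sG : forall n, P n -> s n (G n)).

(** Tracing the contour in [s n] on [G n] makes the carriers disjoint, so the limit over [P] is a
    contour of the next rank. Freeness of [p] discards the finitely many exceptions. *)
Lemma filter_integral_has_contour :
  (forall n, P n -> UltraFilter (s n) /\ has_contour k (s n)) ->
  has_contour k.+1 (filter_integral p s).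
Proof.
move=> sk.
have /choice[W WP] n : exists W, P n -> contour_on k (G n) W /\ W `<=` s n.
  have [Pn|nPn] := pselect (P n); last by exists set0.
  have [sU sc] := sk n Pn.
  by have [W cW Ws] := has_contour_trace sU (sG Pn) sc; exists W.
exists (limit_filter P W).
  exists P, G, W; split=> //; first exact: free_ultra_infinite pP.
  by move=> n /WP[].
move=> A fA; apply/filter_integralE.
apply: filterS (filterI pP (ultra_free_cofinite p_free fA)) => n [Pn nn].
by apply: (WP n Pn).2; apply: contrapT => nWA; apply: nn.
Qed.

Lemma filter_integral_no_contour : selective p ->
  (forall n, P n -> finite_class k (s n)) ->
  ~ has_contour k.+2 (filter_integral p s).
Proof.
move=> psel sk [W /contour_on_limit[I [E [V [Iinf tE EV' WE]]]] Ws].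
have EV i (Ii : I i) : contour_on k.+1 (E i) (V i) := (EV' i Ii).2.
have VP i : I i -> ProperFilter (V i) by move=> /EV; exact: contour_on_proper.
have VE i : I i -> V i (E i) by move=> /EV/contour_on_carrier.
have pW A : limit_filter I V A -> p [set n | s n A].
  by rewrite -WE => /Ws /filter_integralE.
have pE : p [set n | s n (\bigcup_(i in I) E i)].
  apply/pW/limit_filterW => i Ii; have VPi := VP i Ii.
  by apply: filterS (VE i Ii) => x Ex; exists i.
have [pA|/(ultra_setC pU) pB] := pselect (p [set n | exists2 i, I i & s n (E i)]).
  (* First case: [p]-most [s n] contain a carrier, and [d n] is the index of one. *)
  have /choice[d dP] n : exists i, (exists2 i, I i & s n (E i)) -> I i /\ s n (E i).
    have [[i Ii si]|h] := pselect (exists2 i, I i & s n (E i)); first by exists i.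
    by exists 0.
  (* If [d] were [i] on a set in [p], the integral would contain [E i] and also its complement,
     which is in the limit because the carriers are disjoint. *)
  have [[i pd]|[Q pQ dinj]] := psel d.
    have [Ii pEi] : I i /\ p [set n | s n (E i)].
      split; last by apply: filterS (filterI pd pA) => n [/= <- /dP[]].
      by have [n [/= <- /dP[]]] := filter_ex (filterI pd pA).
    have /pW pnEi : limit_filter I V (~` E i).
      apply: sub_finite_set (finite_set1 i) => j [Ij nV]; apply: contrapT => ji.
      have VPj := VP j Ij; apply: nV; apply: filterS (VE j Ij) => x Ejx Eix.
      by apply: ji; apply: tE => //; exists x.
    have [n [[sEi snEi] Pn]] := filter_ex (filterI (filterI pEi pnEi) pP).
    by have [sU _ _] := sk n Pn; apply: (ultra_setC sU _).1 snEi sEi.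
  pose R := (P `&` Q) `&` [set n | exists2 i, I i & s n (E i)].
  have pR : p R by apply: filterI pA; exact: filterI.
  (* [V (d n)] is a contour of rank [k.+1], which [s n] cannot contain. *)
  have /choice[A AP] n : exists A, R n -> V (d n) A /\ ~ s n A.
    have [[[Pn Qn] /dP[Id sd]]|] := pselect (R n); last by exists set0.
    have [_ _ nc] := sk n Pn; have [A nA] : exists A, ~ (V (d n) A -> s n A).
      apply/existsNP => Vs; apply: nc; exists (V (d n)) => //.
      exact: contour_on_sub (EV _ Id).
    by exists A => _; have /not_implyP := nA.
  (* Since [d] is injective on [Q], each carrier is subject to at most one condition, so this set
     lies in every [V i]. *)
  have /pW pX : limit_filter I V [set x | forall n, R n -> E (d n) x -> A n x].
    apply: limit_filterW => i Ii; have VPi := VP i Ii.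
    have [[n Rn dn]|nR] := pselect (exists2 n, R n & d n = i); last first.
      apply: filterS (VE i Ii) => x Eix n Rn Edx; exfalso; apply: nR; exists n => //.
      by apply: tE => //; [case: Rn => _ /dP[]|exists x].
    have [VA _] := AP n Rn; rewrite dn in VA.
    apply: filterS (filterI (VE i Ii) VA) => x [Eix Ax] m Rm Edx.
    suff -> : m = n by [].
    have [[[_ Qm] /dP[Im _]] [[_ Qn] _]] := (Rm, Rn).
    apply: dinj; rewrite ?inE// dn; apply: tE => //; by exists x.
  have [n [Rn sX]] := filter_ex (filterI pR pX).
  have [[Pn Qn] /dP[_ sEd]] := Rn; have [sU _ _] := sk n Pn.
  by apply: (AP n Rn).2; apply: filterS (filterI sX sEd) => x [Xx Ex]; exact: Xx.
have pR : p (P `&` ([set n | s n (\bigcup_(i in I) E i)] `&`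
    ~` [set n | exists2 i, I i & s n (E i)])) by do ! apply: filterI.
(* Second case: [p]-most [s n] contain no carrier. For [k = 0] this is absurd, since a principal
   [s n] contains the carrier that holds its point. *)
case: k sk EV => [|k'] sk EV.
  have [n [Pn [sE nsE]]] := filter_ex pR.
  have [sU [S [x _ ->] xs] _] := sk n Pn.
  have sx : s n [set x] by apply: xs => y.
  have [y [[i Ii Eiy] /= yx]] := filter_ex (filterI sE sx).
  by apply: nsE; exists i => //; apply: filterS sx => _ ->; rewrite -yx.
(* With each [V i] lowered by one, the limit has rank [k'.+2], a rank excluded for [s n]; hence the
   sets [A n], in the limit but not in [s n]. *)
have /choice[V' V'P] i : exists V', I i -> contour_on k'.+1 (E i) V' /\ V' `<=` V i.
  have [Ii|nIi] := pselect (I i); last by exists set0.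
  by have [V' cV' V'V] := contour_on_pred (EV i Ii); exists V'.
have cV' : contour_on k'.+2 setT (limit_filter I V').
  by exists I, E, V'; split=> // i /V'P[].
have /choice[A AP] n : exists A, P n -> limit_filter I V' A /\ ~ s n A.
  have [Pn|nPn] := pselect (P n); last by exists set0.
  have [_ _ nc] := sk n Pn; have [A nA] : exists A, ~ (limit_filter I V' A -> s n A).
    by apply/existsNP => Vs; apply: nc; exists (limit_filter I V').
  by exists A => _; have /not_implyP := nA.
(* A pseudo-intersection: [X] is contained in [A n] up to finitely many [E i]. *)
pose X := [set x | forall i n, I i -> E i x -> n <= i -> V' i (A n) -> A n x].
have /pW pX : limit_filter I V X.
  apply: limit_filterW => i Ii; have [cV'i V'V] := V'P i Ii; apply: V'V.
  have V'F := contour_on_proper cV'i.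
  have V'A : V' i (\bigcap_(n in [set n | n <= i /\ V' i (A n)]) A n).
    apply: filter_bigcap_finite => [|n []//].
    by apply: sub_finite_set (finite_II i.+1) => n [].
  apply: filterS (filterI (contour_on_carrier cV'i) V'A) => x [Eix Ax] j n Ij Ejx nj VA.
  have ij : i = j by apply: tE => //; exists x.
  by apply: Ax; rewrite ij.
have [n [[Pn [sE nsE]] sX]] := filter_ex (filterI pR pX).
have [sU _ _] := sk n Pn; have [limA nsA] := AP n Pn; apply: nsA.
(* As [s n] contains no carrier, finitely many can be removed: those of index below [n] and those
   whose [V' i] misses [A n]. On the remaining ones [X] is inside [A n]. *)
have sB : s n (\bigcap_(i in `I_n `|` [set i | I i /\ ~ V' i (A n)]) 
    (if `[< I i >] then ~` E i else setT)).
  apply: filter_bigcap_finite => [|i _].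
    by rewrite finite_setU; split=> //; exact: finite_II.
  case: asboolP => Ii; last exact: filterT.
  by apply/(ultra_setC sU) => sEi; apply: nsE; exists i.
apply: filterS (filterI sE (filterI sX sB)) => x [[i Ii Eix] [Xx Bx]].
have nB : ~ (`I_n `|` [set i | I i /\ ~ V' i (A n)]) i.
  by move=> /Bx; rewrite asboolT.
apply: (Xx i n Ii Eix).
  by rewrite leqNgt; apply/negP => h; apply: nB; left.
by apply: contrapT => h; apply: nB; right.
Qed.

Lemma filter_integral_finite_class : selective p ->
  (forall n, P n -> finite_class k (s n)) ->
  finite_class k.+1 (filter_integral p s).
Proof.
move=> psel sk; split.
- by apply: filter_integral_ultra; apply: filterS pP => n /sk[].
- by apply: filter_integral_has_contour => n /sk[].
- exact: filter_integral_no_contour.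
Qed.

End Integral.

(** Each [s n] that differs from the integral has a set [B n] outside the integral; [h n] is the
    least [i] with [B i] in [s n]. A constant value [i] of [h] on a set in [p] would put [B i] into
    the integral, so [h] is injective on a set in [p], and removing the earlier sets from [B (h n)]
    gives disjoint sets. *)
Lemma selective_discrete p s : free_ultrafilter p -> selective p ->
  (forall n, UltraFilter (s n)) ->
  p [set n | s n = filter_integral p s] \/
  exists (P : set nat) (G : nat -> set nat),
    [/\ p P, trivIset P G & forall n, P n -> s n (G n)].
Proof.
move=> pf psel sU; have pU := pf.1.
have [|/(ultra_setC pU) pne] := pselect (p [set n | s n = filter_integral p s]).
  by left.
right.
have iU : UltraFilter (filter_integral p s).
  by apply: filter_integral_ultra => //; apply: filterS filterT => n _.
have /choice[B BP] n : exists B, ~ filter_integral p s B /\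
    (s n <> filter_integral p s -> s n B).
  have [->|ne] := pselect (s n = filter_integral p s).
    by exists set0; split=> //; exact: ultra_set0.
  have [B nB] : exists B, ~ (s n B -> filter_integral p s B).
    by apply/existsNP => sB; apply: ne; symmetry; exact: ultra_sub_eq.
  by exists B; have /not_implyP[] := nB.
have /choice[h hP] n : exists i, s n <> filter_integral p s ->
    s n (B i) /\ forall j, j < i -> ~ s n (B j).
  have [->|ne] := pselect (s n = filter_integral p s); first by exists 0.
  have ex : exists i, `[< s n (B i) >] by exists n; apply/asboolP; exact: (BP n).2.
  case: (ex_minnP ex) => i /asboolP sBi imin; exists i => _; split=> // j ji sBj.
  by have := imin j; rewrite leqNgt ji; move/asboolP: sBj => -> /(_ isT).
have [[i pi]|[Q pQ hinj]] := psel h.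
  exfalso; apply: (BP i).1; apply/filter_integralE.
  by apply: filterS (filterI pi pne) => n [/= <- /hP[]].
exists (Q `&` ~` [set n | s n = filter_integral p s]),
  (fun n => B (h n) `&` \bigcap_(j in `I_(h n)) ~` B j); split; first exact: filterI.
- move=> m n [Qm _] [Qn _] [x [[Bmx mx] [Bnx nx]]].
  apply: hinj; rewrite ?inE//.
  have [hmn|hnm|//] := ltngtP (h m) (h n); first by case: (nx _ hmn).
  by case: (mx _ hnm).
- move=> n [_ /hP[sB nsB]]; apply: filterI => //.
  apply: filter_bigcap_finite; first exact: finite_II.
  by move=> j /nsB; exact: (ultra_setC (sU n) _).2.
Qed.

(** * From cascades of finite rank to contours on omega *)

Section CascadeToContour.
Context {d : Order.disp_t} {V : bPOrderType d}.
Implicit Types (v w : V) (A B : set V).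

Lemma contour_sub v A B : A `<=` B -> contour v A -> contour v B.
Proof.
move=> AB cA; elim: cA B AB => {v A} [v A vm Av|v A F vm finF _ IH] B AB.
  by apply: contour_max => //; exact: AB.
apply: (contour_succ vm finF) => w vw nFw; apply: IH => //.
exact: setSI.
Qed.

Lemma contour_trace v A : contour v A -> contour v (A `&` max_above v).
Proof.
move=> cA; elim: cA => {v A} [v A vm Av|v A F vm finF _ IH].
  by apply: contour_max => //; split=> //; split=> //; exact: lexx.
apply: (contour_succ vm finF) => w vw nFw; apply: contour_sub (IH w vw nFw) => x.
by move=> [[Ax [xm wx]] _]; do ! split=> //; exact: le_trans (ltW vw.1) wx.
Qed.

Lemma contour_maxE v A : is_maximal v -> contour v A <-> A v.
Proof.
move=> vm; split=> [cA|]; last exact: contour_max.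
by case: cA vm => // {}v {}A F.
Qed.

(** The traces on [max_above w] disappear: upward closure removes them and [contour_trace] restores
    them. *)
Lemma contour_succE v (e : nat -> V) A : ~ is_maximal v ->
  set_bij [set: nat] (immediate_succ v) e ->
  contour v A <-> finite_set [set i | ~ contour (e i) A].
Proof.
move=> nm [ef ei es]; split=> [cA|fin].
  case: cA nm ef ei es => {v A} [//|v A F _ finF cA nm ef ei es].
  have : finite_set (e @^-1` F).
    by apply: finite_preimage finF => i j _ _; apply: ei; rewrite inE.
  apply: sub_finite_set => i /= ni; apply: contrapT => nFi; apply: ni.
  apply: contour_sub (cA (e i) (ef i I) nFi).
  exact: subIsetl.
apply: (contour_succ nm (finite_image e fin)) => _ /es[i _ <-] ni.
by apply: contour_trace; apply: contrapT => nci; apply: ni; exists i.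
Qed.

(** In a tree the pair of [w] and [w'], both below [x], has a least element, and comparable
    immediate successors of one node coincide. *)
Lemma max_above_succ_disjoint v w w' x : is_tree V -> immediate_succ v w ->
  immediate_succ v w' -> max_above w x -> max_above w' x -> w = w'.
Proof.
move=> tree.
have le_eq u u' : immediate_succ v u -> immediate_succ v u' -> (u <= u')%O -> u = u'.
  move=> [vu _] [_ vu']; rewrite le_eqVlt => /orP[/eqP//|uu'].
  by case: (vu' u).
move=> vw vw' [_ wx] [_ w'x].
have [||a [-> /(_ w' (or_intror erefl)) ww'|-> /(_ w (or_introl erefl)) w'w]] :=
    tree x [set w; w'].
- by move=> y [] ->.
- by exists w; left.
- exact: le_eq.
- by symmetry; exact: le_eq.
Qed.

(** Some successor of a node of rank [k.+1] has rank at least [k]. By monotonicity all later ones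
    have rank exactly [k], and the finitely many earlier ones do not affect the contour. *)
Lemma cascade_contour_on (r : V -> ord) (l : V -> nat) k v :
  is_tree V -> is_rank r -> monotone_cascade r ->
  (forall v w, is_maximal v -> is_maximal w -> l v = l w -> v = w) ->
  oeq (r v) (ord_of_nat k) ->
  contour_on k (l @` max_above v) (fmap l (contour v)).
Proof.
move=> tree rP mono linj; elim: k v => [|k IH] v [rk kr].
  have vm : is_maximal v.
    apply: contrapT => nm; have [e [ef _ _] _] := mono v nm.
    by have := olt_le_trans (((rP v).2 nm).1 (e 0) (ef 0 I)) rk.
  exists (l v); first by exists v => //; split=> //; exact: lexx.
  rewrite eqEsubset; split=> A; first by move=> /(contour_maxE _ vm) /= Alv _ ->.
  by move=> Alv; apply/(contour_maxE _ vm); exact: Alv.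
have nm : ~ is_maximal v.
  by move=> vm; have [r0 _] := (rP v).1 vm; have := ole_trans kr r0 => /(_ 0).
have [e ebij emono] := mono v nm; have [ef ei es] := ebij.
have rlt i : olt (r (e i)) (r v) by apply: ((rP v).2 nm).1; exact: ef.
have rle i : ole (r (e i)) (ord_of_nat k) by have [_] := olt_le_trans (rlt i) rk.
have [i0 ki0] : exists i0, ole (ord_of_nat k) (r (e i0)).
  apply: contrapT => nk; have : ole (r v) (ord_of_nat k).
    apply: ((rP v).2 nm).2 => _ /es[i _ <-].
    by have [kri|//] := ole_or_olt (ord_of_nat k) (r (e i)); case: nk; exists i.
  move=> /(olt_le_trans (olt_le_trans (olt_nat (ltnSn k)) kr)) /olt_nat_inv.
  by rewrite ltnn.
exists [set i | i0 <= i], (fun i => l @` max_above (e i)), (fun i => fmap l (contour (e i))).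
split.
- move=> fin; apply: infinite_nat; rewrite (_ : setT = [set i | i0 <= i] `|` `I_i0).
    by rewrite finite_setU; split=> //; exact: finite_II.
  by rewrite eqEsubset; split=> // i _; case: (leqP i0 i); [left|right].
- move=> i j _ _ [_ [[x ex <-] [y ey yx]]].
  apply: ei; rewrite ?inE //; apply: (max_above_succ_disjoint tree (ef i I) (ef j I) ex).
  by rewrite -(linj _ _ ey.1 ex.1 yx).
- move=> i i0i; split.
    apply: image_subset => x [xm ex]; split=> //.
    exact: le_trans (ltW (ef i I).1) ex.
  apply: IH; split=> //; exact: ole_trans ki0 (emono _ _ i0i).
- rewrite eqEsubset; split=> A.
    by move=> /(contour_succE _ nm ebij); apply: sub_finite_set => i [].
  move=> fin; apply/(contour_succE _ nm ebij).
  have : finite_set ([set i | i0 <= i /\ ~ contour (e i) (l @^-1` A)] `|` `I_i0).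
    by rewrite finite_setU; split=> //; exact: finite_II.
  by apply: sub_finite_set => i /= ni; case: (leqP i0 i); [left|right].
Qed.

End CascadeToContour.

(** * From contours on omega back to cascades of sequences *)

(* The contour of the cascade of sequences of length at most [k]. *)
Fixpoint tree_filter k (A : set (seq nat)) : Prop :=
  if k is k'.+1 then
    finite_set [set i | ~ tree_filter k' [set t | A (i :: t)]]
  else A [::].

(** Enumerating each infinite [I] by all of omega turns every contour of rank [k] into an image of
    one fixed filter: the first entry of a sequence selects the subtree, the rest is labelled inside
    it. Disjoint carriers make the labelling injective. *)
Lemma contour_on_label k D W : contour_on k D W ->
  exists l : seq nat -> nat,
    [/\ forall t, size t = k -> D (l t),
        forall s t, size s = k -> size t = k -> l s = l t -> s = t &
        W = [set A | tree_filter k (l @^-1` A)]].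
Proof.
elim: k D W => [|k IH] D W.
  move=> [x Dx ->]; exists (fun=> x); split=> //.
    by move=> s t /size0nil -> /size0nil ->.
  rewrite eqEsubset; split=> A /= xA; first exact: xA.
  by move=> _ ->.
move=> /contour_on_limit[I [E [V [Iinf tE EV ->]]]].
have /choice[l lP] i : exists l : seq nat -> nat, I i ->
    [/\ forall t, size t = k -> E i (l t),
        forall s t, size s = k -> size t = k -> l s = l t -> s = t &
        V i = [set A | tree_filter k (l @^-1` A)]].
  have [Ii|nIi] := pselect (I i); last by exists (fun=> 0).
  by have [l lP] := IH _ _ (EV i Ii).2; exists l.
have /card_set_bijP[b [bf bi bs]] : ([set: nat] #= I)%card.
  by apply/card_esym/eq_card_nat => //; exact: countableP.
exists (fun t => if t is i :: t' then l (b i) t' else 0); split.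
- by move=> [//|i t] [tk]; have Ib := bf i Logic.I; apply: (EV _ Ib).1;
  have [+ _ _] := lP _ Ib; apply.
- move=> [//|i s] [//|j t] [sk] [tk] st.
  have [Ibi Ibj] := (bf i Logic.I, bf j Logic.I).
  have [Ei li _] := lP _ Ibi; have [Ej lj _] := lP _ Ibj.
  have bij : b i = b j.
    apply: tE => //; exists (l (b i) s); split; first exact: Ei.
    by rewrite st; exact: Ej.
  have ij : i = j by apply: bi; rewrite ?inE.
  by rewrite ij; congr cons; rewrite ij in st li; exact: li.
- rewrite eqEsubset; split=> A /= fin.
    have : finite_set (b @^-1` [set i | I i /\ ~ V i A]).
      by apply: finite_preimage fin => i j _ _; apply: bi; rewrite inE.
    apply: sub_finite_set => i /= ni; have Ib := bf i Logic.I; split=> //.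
    by have [_ _ ->] := lP _ Ib.
  apply: sub_finite_set (finite_image b fin) => j [Ij nV].
  have [i _ ij] := bs j Ij; exists i => //= h; apply: nV.
  by rewrite -ij; have [_ _ ->] := lP _ (bf i Logic.I).
Qed.

Definition bounded_seq k := {s : seq nat | size s <= k}.

HB.instance Definition _ k := Choice.on (bounded_seq k).

Section PrefixCascade.
Variable k : nat.
Implicit Types s t : bounded_seq k.

Definition prefix_le s t := prefix (val s) (val t).

Lemma prefix_le_refl : reflexive prefix_le.
Proof. by move=> s; exact: prefix_refl. Qed.

Lemma prefix_le_anti : antisymmetric prefix_le.
Proof.
move=> s t /andP[/prefixP[a ta] /prefixP[b sb]]; apply: val_inj.
move/(congr1 size): (sb); rewrite ta !size_cat => /eqP.
rewrite -addnA -[X in X == _]addn0 eqn_add2l eq_sym addn_eq0 => /andP[/eqP/size0nil a0 _].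
by rewrite a0 cats0.
Qed.

Lemma prefix_le_trans : transitive prefix_le.
Proof. by move=> s t u; exact: prefix_trans. Qed.

HB.instance Definition _ := Order.Le_isPOrder.Build (Order.Disp tt tt)
  (bounded_seq k) prefix_le_refl prefix_le_anti prefix_le_trans.

Definition empty_seq : bounded_seq k := exist _ [::] (leq0n k).

Lemma empty_seq_le s : (empty_seq <= s)%O.
Proof. exact: prefix0s. Qed.

HB.instance Definition _ := Order.hasBottom.Build (Order.Disp tt tt)
  (bounded_seq k) empty_seq_le.

(** At full length [k] the default value is [s] itself. *)
Definition child s i : bounded_seq k := insubd s (rcons (val s) i).

Lemma val_child s i : size (val s) < k -> val (child s i) = rcons (val s) i.
Proof. by move=> sk; rewrite val_insubd size_rcons sk. Qed.

Lemma bounded_maximal s : is_maximal s <-> size (val s) = k.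
Proof.
split=> [sm|sk t /prefixP[u tE]].
  apply/eqP; rewrite eqn_leq (valP s) leqNgt; apply/negP => sk.
  have /(congr1 val) : child s 0 = s.
    by apply: sm; rewrite /Order.le /= /prefix_le val_child // prefix_rcons.
  rewrite val_child // => /(congr1 size) /eqP.
  by rewrite size_rcons -[X in _ == X]addn0 -addn1 eqn_add2l.
have := valP t; rewrite tE size_cat sk -[X in _ <= X]addn0 leq_add2l leqn0 => /eqP/size0nil u0.
by apply: val_inj; rewrite tE u0 cats0.
Qed.

Lemma bounded_not_maximal s : ~ is_maximal s <-> size (val s) < k.
Proof.
rewrite bounded_maximal ltn_neqAle (valP s) andbT.
by split=> [/eqP|/eqP].
Qed.

Lemma child_bij s : ~ is_maximal s ->
  set_bij [set: nat] (immediate_succ s) (child s).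
Proof.
move=> /bounded_not_maximal sk; split.
- move=> i _; split.
    rewrite lt_def; apply/andP; split.
      apply/eqP => /(congr1 val); rewrite val_child // => /(congr1 size)/eqP.
      by rewrite size_rcons -[X in _ == X]addn0 -addn1 eqn_add2l.
    by rewrite /Order.le /= /prefix_le val_child // prefix_rcons.
  move=> t [/[dup] /ltW /prefixP[a ta] st]; rewrite lt_def => /andP[/eqP ct].
  move=> /prefixP[b cb]; rewrite val_child // ta -cats1 -catA in cb.
  move/eqP: cb; rewrite eqseq_cat // eqxx /= => /eqP.
  case: a ta => [|j a] ta /=.
    by move: st; rewrite (_ : s = t) ?ltxx //; apply: val_inj; rewrite ta cats0.
  move=> [ij]; case: a ta => // ta _; apply: ct; apply: val_inj.
  by rewrite val_child // ta ij cats1.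
- by move=> i j _ _ /(congr1 val); rewrite !val_child // => /rcons_inj[].
- move=> t [st nt]; have /prefixP[[|i a] ta] := ltW st.
    by move: st; rewrite (_ : s = t) ?ltxx //; apply: val_inj; rewrite ta cats0.
  exists i => //; apply: contrapT => ct; apply: (nt (child s i)); split.
    rewrite lt_def; apply/andP; split.
      apply/eqP => /(congr1 val); rewrite val_child // => /(congr1 size)/eqP.
      by rewrite size_rcons -[X in _ == X]addn0 -addn1 eqn_add2l.
    by rewrite /Order.le /= /prefix_le val_child // prefix_rcons.
  rewrite lt_def; apply/andP; split; first by apply/eqP => e; apply: ct.
  rewrite /Order.le /= /prefix_le val_child // ta -cats1 -[_ :: a]cat1s catA.
  exact: prefix_prefix.
Qed.

(** Among prefixes of one sequence the shortest is least; a chain has at most one member of each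
    length up to [k]. *)
Lemma bounded_cascade : is_cascade (bounded_seq k).
Proof.
split=> [v A Av [a0 Aa0]|C [Ctot _]].
  have ex : exists n, `[< exists2 a, A a & size (val a) = n >].
    by exists (size (val a0)); apply/asboolP; exists a0.
  case: (ex_minnP ex) => n /asboolP[a Aa an] nmin; exists a => // b Ab.
  have ab : size (val a) <= size (val b).
    by rewrite an; apply: nmin; apply/asboolP; exists b.
  have [/= av bv] := (Av a Aa, Av b Ab).
  rewrite /Order.le /= /prefix_le !prefixE in av bv *.
  by rewrite -(eqP bv) take_takel.
pose g n := xget (empty_seq) [set c | C c /\ size (val c) = n].
apply: sub_finite_set (finite_image g (finite_II k.+1)) => c Cc.
exists (size (val c)); first exact: valP c.
have [Cg gc] : C (g (size (val c))) /\ size (val (g (size (val c)))) = size (val c).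
  by apply: (@xgetPex _ empty_seq [set x | C x /\ size (val x) = size (val c)]); exists c.
apply: val_inj; have := Ctot _ _ Cg Cc.
by rewrite /Order.le /= /prefix_le !prefixE gc take_oversize //
  take_oversize ?gc // => -[/eqP|/eqP].
Qed.

Definition height s := ord_of_nat (k - size (val s)).

Lemma height_rank : is_rank height.
Proof.
move=> s; split=> [/bounded_maximal sk|nm]; first by rewrite /height sk subnn.
have sk := (bounded_not_maximal s).1 nm; have [cf _ cs] := child_bij nm.
have hE i : height s = OLsub (fun=> height (child s i)).
  by rewrite /height val_child // size_rcons -subSS subSn.
split=> [_ /cs[i _ <-]|b bP].
  by rewrite (hE i); exists 0; exact: ole_refl.
have := bP _ (cf 0 I); rewrite (hE 0).
by case: b {bP} => // b [n bn] _; exists n.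
Qed.

Lemma bounded_contourE j s (B : set (seq nat)) : j + size (val s) = k ->
  contour s [set t : bounded_seq k | B (val t)] <->
  tree_filter j [set t | B (val s ++ t)].
Proof.
elim: j s B => [|j IH] s B jk.
  by rewrite contour_maxE; [rewrite /= cats0|exact/bounded_maximal].
have sk : size (val s) < k by rewrite -[X in _ < X]jk addSn ltnS leq_addl.
rewrite (contour_succE _ _ (child_bij _)); try exact/bounded_not_maximal.
suff -> : [set i | ~ contour (child s i) [set t : bounded_seq k | B (val t)]] =
  [set i | ~ tree_filter j [set t | B (val s ++ i :: t)]] by [].
apply/seteqP; split=> i /= ni h; apply: ni.
  apply/IH; first by rewrite val_child // size_rcons addnS -addSn.
  rewrite val_child //; move: h; congr tree_filter.
  by apply/funext => t /=; rewrite cat_rcons.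
move/IH: h; rewrite val_child // size_rcons addnS -addSn => /(_ jk).
by congr tree_filter; apply/funext => t /=; rewrite cat_rcons.
Qed.

End PrefixCascade.

(** * The notions of the statement at finite index *)

Lemma monotone_sequential_contourE k b W : oeq b (ord_of_nat k) ->
  monotone_sequential_contour b W <-> contour_on k setT W.
Proof.
move=> [bk kb]; split.
  move=> [d [V [r [l [[[tree _] _] [rP [rb br]] mono linj ->]]]]].
  apply: contour_on_sub (cascade_contour_on tree rP mono linj _) => //.
  by split; [exact: ole_trans rb bk|exact: ole_trans kb br].
move=> /contour_on_label[l [_ linj ->]].
exists (Order.Disp tt tt), (bounded_seq k), (@height k), (fun s => l (val s)); split.
- split; first exact: bounded_cascade.
  move=> s nm; have [cf ci cs] := child_bij nm.
  have -> : immediate_succ s = child s @` setT.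
    by rewrite eqEsubset; split=> // _ [i _ <-]; exact: cf.
  exact: inj_card_eq ci.
- by split; [exact: height_rank|rewrite /height /= subn0].
- move=> s nm; exists (child s); first exact: child_bij.
  move=> i j _; rewrite /height !val_child ?size_rcons; try exact/bounded_not_maximal.
  exact: ole_refl.
- move=> s t /bounded_maximal sk /bounded_maximal tk st; apply: val_inj.
  exact: linj.
- rewrite eqEsubset; split=> A /=.
    by move=> h; apply/(@bounded_contourE k k _ (l @^-1` A)); rewrite /= ?addn0.
  by move=> /(@bounded_contourE k k _ (l @^-1` A)); apply; rewrite /= addn0.
Qed.

(** The largest rank required is [k], and [has_contour_le] supplies the smaller positive ones. For
    [k = 0] no positive rank is required, and excluding rank one makes [u] principal. *)
Lemma ordinal_classE k b u : oeq b (ord_of_nat k.+1) ->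
  ordinal_class b u <-> finite_class k u.
Proof.
move=> bk; split=> [[b0 uU nc hc]|[uU uk nuk]].
  have nuk : ~ has_contour k.+1 u.
    by move=> [W /(monotone_sequential_contourE _ bk) /nc].
  split=> //; case: k bk nuk => [|k] bk nuk; first exact: principal_has_contour.
  have [||W cW Wu] := hc (ord_of_nat k.+1); first exact: (@olt_nat 0).
    exact: olt_le_trans (olt_nat (ltnSn k.+1)) bk.2.
  by exists W => //; exact: (monotone_sequential_contourE W (oeq_refl _)).1 cW.
split=> //; first exact: olt_le_trans (@olt_nat 0 k.+1 isT) bk.2.
  by move=> W /(monotone_sequential_contourE _ bk) cW Wu; apply: nuk; exists W.
move=> a a0 ab; have [j jk aj] := olt_nat_between a0 (olt_le_trans ab bk.1).
case: k {bk nuk ab} jk uk => // k jk /(@has_contour_le j k u jk)[W cW Wu].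
by exists W => //; apply/(monotone_sequential_contourE _ aj).
Qed.

Lemma relatively_rk_minimalE k u : relatively_rk_minimal (ord_of_nat k.+1) u <->
  finite_class k u /\ forall f : nat -> nat, rk_equiv u (fmap f u) \/
    exists2 j, j < k & finite_class j (fmap f u).
Proof.
rewrite /relatively_rk_minimal (ordinal_classE _ (oeq_refl _)).
split=> -[uk rel]; split=> // f; (have [|] := rel f; first by left) => -[].
  move=> b bk fb; have [b0 _ _ _] := fb.
  have [j jk bj] := olt_nat_between b0 bk.
  by right; exists j => //; exact/(ordinal_classE _ bj).
move=> j jk fj; right; exists (ord_of_nat j.+1); first exact: olt_nat.
exact/(ordinal_classE _ (oeq_refl _)).
Qed.

(** * Integrals of relatively minimal ultrafilters *)

Theorem theorem4p4 (m : nat) (p : set_system nat) (q : nat -> set_system nat)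
    (q_discrete : discrete_sequence q)
    (q_free : forall n, free_ultrafilter (q n))
    (q_min : forall n, relatively_rk_minimal (ord_of_nat m) (q n))
    (p_min : rk_minimal p) :
  relatively_rk_minimal (ord_of_nat m.+1) (filter_integral p q).
Proof.
(* For [m = 0] the assumption on [q] is contradictory, the class of index zero being empty. *)
case: m q_min => [/(_ 0)[[]]//|k] q_min.
have pf := p_min.1; have pU := pf.1; have psel := rk_minimal_selective p_min.
have qk n : finite_class k (q n) := ((relatively_rk_minimalE _ _).1 (q_min n)).1.
have qU n : UltraFilter (q n) by have [] := qk n.
have [U qUn tU] := q_discrete.
have uk : finite_class k.+1 (filter_integral p q).
  exact: (filter_integral_finite_class pf filterT tU).
have [uU _ _] := uk.
apply/relatively_rk_minimalE; split=> // f; rewrite filter_integral_fmap //.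
pose s n := fmap f (q n); have sU n : UltraFilter (s n) by exact: ultra_fmap.
have sk n : rk_equiv (q n) (s n) \/ exists2 j, j < k & finite_class j (s n).
  by have [_ /(_ f)] := (relatively_rk_minimalE _ _).1 (q_min n).
have [pconst|[P [G [pP tG sG]]]] := selective_discrete pf psel sU.
  (* The image is a single [s n], whose class index is at most [k], hence below [k.+1]. *)
  have [n <-] := filter_ex pconst; right.
  have [/(finite_class_fmap (qk n)) snk|[j jk snj]] := sk n; first by exists k.
  by exists j => //; exact: ltnW.
have tGI Q : trivIset (P `&` Q) G by move=> i j [Pi _] [Pj _]; exact: tG.
have [pe|/(ultra_setC pU) pne] := pselect (p [set n | rk_equiv (q n) (s n)]).
  left; have /choice[F FP] n : exists F, rk_equiv (q n) (s n) ->
      q n F /\ {in F &, injective f}.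
    have [e|] := pselect (rk_equiv (q n) (s n)); last by exists set0.
    by have [F qF fi] := rk_equiv_fmap_inj (qU n) e.2; exists F.
  rewrite -filter_integral_fmap //.
  (* Two points of this set with the same image share a [G n]; disjointness determines [n], and [f]
     is injective on [F n]. *)
  apply: (inj_rk_equiv (U := [set x | exists n,
    [/\ (P `&` [set n | rk_equiv (q n) (s n)]) n, F n x & G n (f x)]])).
    apply/filter_integralE; apply: filterS (filterI pP pe) => n [Pn en] /=.
    have Gn : q n (f @^-1` G n) := sG n Pn.
    apply: filterS (filterI (FP n en).1 Gn) => x [Fx Gx].
    by exists n.
  move=> x y; rewrite !inE => -[n [Pn Fx Gx]] [n' [Pn' Fy Gy]] xy.
  have nn : n = n' by apply: (tGI _ _ _ Pn Pn'); exists (f x); split=> //; rewrite xy.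
  by apply: (FP n Pn.2).2; rewrite ?inE // nn.
(* Only finitely many classes are possible, so one of them is taken by [p]-most [s n]. *)
have [j jk pj] : exists2 j, j < k & p [set n | finite_class j (s n)].
  apply: ultra_finite_cover; apply: filterS pne => n /=.
  by have [//|[j jk sj] _] := sk n; exists j.
right; exists j.+1 => //.
apply: (filter_integral_finite_class pf (filterI pP pj) (tGI _)) => //.
  by move=> n [/sG].
by move=> n [].
Qed.
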